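(* Let $d\ge2$ and let $\varphi:\mathcal{P}_d\to\mathbb{R}$ be a Minkowski linear functional. Then $\varphi$ is positive, translation-invariant and symmetric if and only if there are real numbers $c_1,\dots,c_{d-1}\ge0$ such that \[\varphi=\sum_{k=1}^{d-1}c_kf_k.\] In particular, the family of all positive, symmetric, translation-invariant Minkowski linear functionals on $\mathcal{P}_d$ forms a simplicial cone of dimension $d-1$.
   Context: $\Delta_I=\mathrm{conv}\{e_i:i\in I\}$ for $\emptyset\ne I\subseteq[d]$, $\Delta_\emptyset=\{0\}$, and $\Delta_i:=\Delta_{[i]}$. $\mathcal{P}_d$ is the class of generalized permutahedra in $\mathbb{R}^d$: polytopes which are Minkowski summands of $\lambda\Pi_d$ for some $\lambda>0$, where $\Pi_d=\mathrm{conv}\{(\sigma(1),\dots,\sigma(d)):\sigma\in S_d\}$. Every $P\in\mathcal{P}_d$ has a unique signed Minkowski representation $P=\sum_{\emptyset\ne I}y_I\Delta_I$ (meaning $P+\sum_{y_I<0}(-y_I)\Delta_I=\sum_{y_I\ge0}y_I\Delta_I$). A map $\varphi:\mathcal{P}_d\to\mathbb{R}$ is Minkowski linear if $\varphi(\emptyset)=0$ and $\varphi(\lambda P+\mu Q)=\lambda\varphi(P)+\mu\varphi(Q)$ for $P,Q\in\mathcal{P}_d$, $\lambda,\mu\ge0$; it is then determined by the values $\varphi(\Delta_I)$ via $\varphi(\sum y_I\Delta_I)=\sum y_I\varphi(\Delta_I)$. It is positive if $\varphi\ge0$ on $\mathcal{P}_d$, translation-invariant if $\varphi(P+t)=\varphi(P)$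 for $t\in\mathbb{R}^d$, and symmetric if $\varphi(\sigma(P))=\varphi(P)$ for every permutation $\sigma$ of coordinates. For $1\le k\le d-1$, $f_k$ is the symmetric, translation-invariant Minkowski linear functional with $f_k(\Delta_{i+1})=\binom{i+1}{2}\binom{d-i-1}{k-i}$ for $1\le i\le d-1$ (equivalently $f_k(\Delta_I)=\binom{|I|}{2}\binom{d-|I|}{k-|I|+1}$ for nonempty $I$), with $\binom{n}{m}=0$ for $m<0$ or $m>n$. *)

(* Defs.v *)
From HB Require Import structures.
From mathcomp Require Import all_boot all_order all_algebra all_fingroup.
From mathcomp Require Import all_classical all_reals.
Set Implicit Arguments.
Unset Strict Implicit.
Unset Printing Implicit Defensive.
Import Order.TTheory GRing.Theory Num.Theory.
Local Open Scope classical_set_scope.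
Local Open Scope ring_scope.

Section Polytopes.
Variables (R : realType) (d : nat).
Implicit Types (A B P Q : set 'rV[R]_d).

Definition conv A : set 'rV[R]_d :=
  [set x | exists n (w : 'I_n -> R) (p : 'I_n -> 'rV[R]_d),
     [/\ forall i, 0 <= w i, \sum_i w i = 1, forall i, A (p i)
       & x = \sum_i w i *: p i]].

Definition polytope P := exists2 A, finite_set A & P = conv A.

Definition mink_add A B : set 'rV[R]_d := [set x + y | x in A & y in B].

Definition dilate (l : R) A : set 'rV[R]_d := [set l *: x | x in A].

Definition translate A (t : 'rV[R]_d) : set 'rV[R]_d := [set x + t | x in A].

Definition permute (s : 'S_d) A : set 'rV[R]_d := [set col_perm s x | x in A].

(* The values of s : 'S_d are 0, ..., d-1, hence the successor. *)
Definition permutahedron : set 'rV[R]_d :=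
  conv [set \row_i (s i).+1%:R | s in [set: 'S_d]].

Definition simplex (I : {set 'I_d}) : set 'rV[R]_d :=
  if I == finset.set0 then [set 0]
  else conv [set delta_mx 0 i | i in [set` I]].

(* Delta_i = Delta_[i], where [i] = {1, ..., i} is {0, ..., i-1} in 'I_d. *)
Definition std_simplex (i : nat) : set 'rV[R]_d :=
  simplex [set j : 'I_d | (j < i)%N]%SET.

(* The class P_d; its members are nonempty, the permutahedron being so. *)
Definition genperm P :=
  polytope P /\
  exists2 l : R, 0 < l &
    exists2 Q, polytope Q & mink_add P Q = dilate l permutahedron.

End Polytopes.

Arguments permutahedron R d : clear implicits.
Arguments std_simplex R d i : clear implicits.

(* A map P_d -> R is encoded by its extension by 0 to all subsets of R^d, so
   that two such maps are equal exactly when they agree on P_d.  The empty set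
   is not in P_d, and the convention phi(set0) = 0 agrees with this encoding. *)
Notation functional R d := (set 'rV[R]_d -> R^o).

Section Functionals.
Variables (R : realType) (d : nat).
Implicit Types (phi : functional R d).

Definition mink_linear phi :=
  [/\ forall A, ~ genperm A -> phi A = 0,
      phi set0 = 0
    & forall P Q (l m : R), genperm P -> genperm Q -> 0 <= l -> 0 <= m ->
        phi (mink_add (dilate l P) (dilate m Q)) = l * phi P + m * phi Q].

Definition positive phi := forall P, genperm P -> 0 <= phi P.

Definition translation_invariant phi :=
  forall P t, genperm P -> phi (translate P t) = phi P.

Definition symmetric_functional phi :=
  forall P (s : 'S_d), genperm P -> phi (permute s P) = phi P.

(* binom(i+1, 2) * binom(d-i-1, k-i); the guard makes the second factor 0 when
   k - i is negative, which truncated subtraction would not. *)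
Definition f_value (k i : nat) : nat :=
  ('C(i.+1, 2) * (if (i <= k)%N then 'C(d - i.+1, k - i) else 0))%N.

(* The functional with these properties: it exists because every member of P_d
   has a signed Minkowski representation by simplices, along which phi extends,
   and it is unique, the value at a point being 0 by translation-invariance.
   The default value 0 of xget plays no role. *)
Definition fk (k : nat) : functional R d :=
  xget 0 [set phi : functional R d |
    [/\ mink_linear phi, translation_invariant phi, symmetric_functional phi
      & forall i, (1 <= i <= d.-1)%N ->
          phi (std_simplex R d i.+1) = (f_value k i)%:R]].

End Functionals.

Arguments fk R d k : clear implicits.

Section SimplicialCones.
Variables (R : realType) (V : lmodType R).

Definition lin_indep n (v : 'I_n -> V) :=
  forall a : 'I_n -> R, \sum_i a i *: v i = 0 -> forall i, a i = 0.

Definition simplicial_cone (n : nat) (K : set V) :=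
  exists2 v : 'I_n -> V, lin_indep v &
    K = [set x | exists2 c : 'I_n -> R,
                   forall i, 0 <= c i & x = \sum_i c i *: v i].

End SimplicialCones.

(* Main.v *)
(* A generalized permutahedron P is the base polytope of its support function
   z(I) = max_P x(I), which is submodular, and conversely.  The Minkowski sum
   is the sum of these set functions, so a Minkowski linear functional is an
   additive, positively homogeneous functional on the cone of submodular
   functions.
   If phi is symmetric, phi(P) is the average of phi over the permuted copies
   of P, that is, up to the factor 1/d!, the value of phi at
   sum_s z(s I) = g(|I|) with g concave.  Such a function is a modular one plus
   sum_j (- second difference of g at j) min(|I|, j), with nonnegative
   coefficients; translation invariance kills the modular part.  So phi is a
   combination of the d - 1 second differences, whose coefficients are the
   values of phi at the hypersimplices min(|I|, j).  The second differences are
   positive functionals; evaluated at a simplex they give, up to a constant,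
   the values defining f_k with k = d - j. *)
Require Import Defs.
From HB Require Import structures.
From mathcomp Require Import all_boot all_order all_algebra all_fingroup.
From mathcomp Require Import all_classical all_reals.
From mathcomp Require Import ring lra zify.
Import Order.TTheory GRing.Theory Num.Theory.
Local Open Scope classical_set_scope.
Local Open Scope ring_scope.

(** * Convex hulls, Farkas' lemma and separation from finitely many points *)

Section ConvexHulls.
Set Implicit Arguments.
Unset Strict Implicit.
Unset Printing Implicit Defensive.
Variable R : realType.

Lemma conv_fin (d : nat) (T : finType) (A : set 'rV[R]_d) (w : T -> R)
    (p : T -> 'rV[R]_d) :
  (forall t, 0 <= w t) -> \sum_t w t = 1 -> (forall t, A (p t)) ->
  conv A (\sum_t w t *: p t).
Proof.
move=> w0 w1 Ap; exists #|T|, (w \o enum_val), (p \o enum_val).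
split=> [i|| i|] //=.
- by rewrite -[RHS]w1 (reindex _ (onW_bij _ (@enum_val_bij T))) /=.
- by rewrite (reindex _ (onW_bij _ (@enum_val_bij T))) /=.
Qed.

(** Nested convex combinations are flattened over the dependent pairs of an outer and an inner
    index, the weights being multiplied. *)
Lemma conv_sum (d : nat) (T : finType) (A : set 'rV[R]_d) (w : T -> R)
    (p : T -> 'rV[R]_d) :
  (forall t, 0 <= w t) -> \sum_t w t = 1 -> (forall t, conv A (p t)) ->
  conv A (\sum_t w t *: p t).
Proof.
move=> w0 w1 Ap.
have /choice [n hn] : forall t, exists n (vq : 'I_n -> R * 'rV[R]_d),
    [/\ forall i, 0 <= (vq i).1, \sum_i (vq i).1 = 1, forall i, A (vq i).2
      & p t = \sum_i (vq i).1 *: (vq i).2].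
  by move=> t; have [n [v [q [h1 h2 h3 h4]]]] := Ap t; exists n, (fun i => (v i, q i)).
pose f t := projT1 (cid (hn t)).
have hf t : [/\ forall i, 0 <= (f t i).1, \sum_i (f t i).1 = 1,
    forall i, A (f t i).2 & p t = \sum_i (f t i).1 *: (f t i).2].
  by rewrite /f; case: (cid (hn t)).
have -> : \sum_t w t *: p t = \sum_(u : {t : T & 'I_(n t)})
    (w (tag u) * (f _ (tagged u)).1) *: (f _ (tagged u)).2.
  rewrite -(@sig_big_dep _ _ _ T (fun t => 'I_(n t)) xpredT (fun=> xpredT)
     (fun t i => (w t * (f t i).1) *: (f t i).2)) /=.
  apply: eq_bigr => t _; have [_ _ _ ->] := hf t.
  by rewrite scaler_sumr; apply: eq_bigr => i _; rewrite scalerA.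
apply: conv_fin => [u||u].
- by have [h _ _ _] := hf (tag u); rewrite mulr_ge0.
- rewrite -(@sig_big_dep _ _ _ T (fun t => 'I_(n t)) xpredT (fun=> xpredT)
     (fun t i => (w t * (f t i).1))) /= -[RHS]w1.
  by apply: eq_bigr => t _; have [_ h _ _] := hf t; rewrite -mulr_sumr h mulr1.
- by have [_ _ h _] := hf (tag u).
Qed.

(* Bartl's induction: if the new functional [a t] is needed, project along a
   point [w0] violating the implication for the previous ones. *)
Lemma farkas (W : lmodType R) (T : eqType) (r : seq T) :
  uniq r -> forall (a : T -> W -> R) (b : W -> R),
  (forall t c x y, a t (c *: x + y) = c * a t x + a t y) ->
  (forall c x y, b (c *: x + y) = c * b x + b y) ->
  (forall w, (forall t, t \in r -> a t w <= 0) -> b w <= 0) ->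
  exists2 l : T -> R, forall t, 0 <= l t &
    forall w, b w = \sum_(t <- r) l t * a t w.
Proof.
elim: r => [|t r IH] /= ur a b la lb hab.
  exists (fun=> 0) => // w; rewrite big_nil.
  have b0 : forall w, b w <= 0 by move=> v; apply: hab.
  apply/eqP; rewrite eq_le b0 /=.
  have bz : b 0 = 0 by have := lb 1 0 0; rewrite scaler0 addr0; lra.
  by have := lb (-1) w 0; rewrite addr0 bz; have := b0 (-1 *: w); lra.
move: ur => /andP[tr ur].
have [h|/existsNP [w0 /not_implyP [hw0 /negP]]] :=
    pselect (forall w, (forall t, t \in r -> a t w <= 0) -> b w <= 0).
  have [l l0 hl] := IH ur a b la lb h.
  exists (fun s => if s == t then 0 else l s) => [s|w]; first by case: ifP.
  rewrite big_cons eqxx mul0r add0r hl; apply: eq_big_seq => s sr.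
  by case: eqP => // st; rewrite -st sr in tr.
rewrite -ltNge => bw0.
have aw0 : 0 < a t w0.
  rewrite ltNge; apply/negP => at0; suff : b w0 <= 0 by lra.
  by apply: hab => s; rewrite in_cons => /orP[/eqP ->//|]; apply: hw0.
pose v := (a t w0)^-1 *: w0.
have sc f (hf : forall c x y, f (c *: x + y) = c * f x + f y) (c : R) (x : W) :
    f (c *: x) = c * f x.
  have fz : f 0 = 0 by have := hf 1 0 0; rewrite scaler0 addr0; lra.
  by have := hf c x 0; rewrite !addr0 fz addr0.
have av : a t v = 1 by rewrite /v (sc _ (la t)) mulVf ?gt_eqF.
have bv : 0 < b v by rewrite /v (sc _ lb) mulr_gt0 ?invr_gt0.
have rv s : s \in r -> a s v <= 0.
  by move=> sr; rewrite /v (sc _ (la s)) pmulr_rle0 ?invr_gt0 ?hw0.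
(* These are the functionals composed with the projection [w - a t w *: v] onto the kernel of
   [a t]. *)
have [||x hx|l l0 hl] := IH ur (fun s w => a s w - a s v * a t w)
    (fun w => b w - b v * a t w).
- by move=> s c x y; rewrite !la; ring.
- by move=> c x y; rewrite lb la; ring.
- have := hab (- a t x *: v + x); rewrite lb => h.
  suff: - a t x * b v + b x <= 0 by lra.
  apply: h => s; rewrite in_cons la => /orP[/eqP ->|sr]; first by rewrite av; lra.
  by have := hx s sr; lra.
(* The multiplier of [a t] is what remains after expanding the projected identity. It is nonnegative
   because [b v] is positive and each [a s v] is at most 0. *)
exists (fun s => if s == t then b v - \sum_(s <- r) l s * a s v else l s).
  move=> s; case: (s == t) => //; rewrite subr_ge0 (le_trans _ (ltW bv)) //.
  rewrite big_seq_cond; apply: sumr_le0 => s' /andP[s'r _].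
  by rewrite mulr_ge0_le0 ?rv.
move=> w; rewrite big_cons eqxx.
rewrite [X in _ = _ + X](eq_big_seq (fun s => l s * a s w)); last first.
  by move=> s sr /=; rewrite ifN_eq //; apply: contraNneq tr => <-.
have := hl w => /=; under eq_bigr do rewrite mulrBr mulrA.
by rewrite big_split /= sumrN -mulr_suml; lra.
Qed.

Definition dot d (u x : 'rV[R]_d) := \sum_i u 0 i * x 0 i.

(** Farkas' lemma for the affine functions [(u, c) |-> dot u y + c]. The multipliers are the
    weights: evaluation at [(0, 1)] shows that they sum to 1, and evaluation at [(delta_mx 0 j, 0)]
    gives the coordinates of [x]. *)
Lemma conv_of_separation (d : nat) (T : finType) (v : T -> 'rV[R]_d) x :
  (forall u, exists t, dot u x <= dot u (v t)) -> conv (range v) x.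
Proof.
move=> h; pose g (y : 'rV[R]_d) (w : 'rV[R]_d * R^o) := dot w.1 y + w.2.
have lg y c w w' : g y (c *: w + w') = c * g y w + g y w'.
  rewrite /g /= /dot.
  under eq_bigr do rewrite !mxE mulrDl -mulrA.
  rewrite big_split /= -mulr_sumr.
  have -> : c *: w.2 = c * w.2 by [].
  by ring.
have [w hw|l l0 hl] := @farkas ('rV[R]_d * R^o)%type T (enum T) (enum_uniq _) (fun t => g (v t))
    (g x) (fun t => lg (v t)) (lg x).
  have [t ht] := h w.1.
  by have := hw t; rewrite mem_enum => /(_ isT); rewrite /g; lra.
have l1 : \sum_t l t = 1.
  have := hl (0, 1); rewrite /g /= /dot big1 => [|i _]; last by rewrite mxE mul0r.
  rewrite add0r => ->; rewrite [RHS]big_enum /=; apply: eq_bigr => t _.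
  by rewrite big1 ?add0r ?mulr1 // => i _; rewrite mxE mul0r.
suff -> : x = \sum_t l t *: v t by apply: conv_fin => // t; exists t.
apply/rowP => j.
have D y : g y (delta_mx 0 j, 0) = y 0 j.
  rewrite /g /dot /= addr0 (bigD1 j) //= mxE !eqxx mul1r big1 ?addr0 // => i ij.
  by rewrite mxE (negPf ij) andbF mul0r.
rewrite -(D x) hl big_enum summxE; apply: eq_bigr => t _.
by rewrite D mxE.
Qed.

End ConvexHulls.

(** * Permutations sorting a real vector in decreasing order *)

Section Rank.

Lemma rank_perm (R : realType) (d : nat) (u : 'I_d -> R) :
  exists s : 'S_d, forall i j, u j < u i -> (s i < s j)%N.
Proof.
(* Ties are broken by the index, which makes [r] a strict total order; the position of [j] is then
   its number of predecessors. *)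
pose r (i j : 'I_d) := (u j < u i) || ((u i == u j) && (i < j)%N).
have rir i : ~~ r i i by rewrite /r ltxx ltnn andbF.
have rtr i j k : r i j -> r j k -> r i k.
  rewrite /r => /orP[h1|/andP[/eqP-> h1]] /orP[h2|/andP[/eqP<- h2]].
  - by rewrite (lt_trans h2 h1).
  - by rewrite h1.
  - by rewrite h2.
  - by rewrite eqxx (ltn_trans h1 h2) orbT.
have rto i j : i != j -> r i j || r j i.
  rewrite -(inj_eq val_inj) /r /=; case: (ltgtP (u i) (u j)) => //= _.
  by rewrite neq_ltn.
pose rk j := #|[set i | r i j]%SET|.
have rkm i j : r i j -> (rk i < rk j)%N.
  move=> rij; apply: proper_card; apply/properP; split.
    by apply/fintype.subsetP => k; rewrite !inE => /rtr; apply.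
  by exists i; rewrite !inE.
have rkd j : (rk j < d)%N.
  rewrite -[X in (_ < X)%N]card_ord -cardsT; apply: proper_card.
  by apply/properP; split; [exact: finset.subsetT | exists j; rewrite !inE].
have rki : injective (fun j => Ordinal (rkd j)).
  move=> i j /(congr1 val) /= eij; apply/eqP; apply: contraT => /rto.
  by case/orP => /rkm; rewrite eij ltnn.
exists (perm rki) => i j uij; rewrite !permE /=.
by apply: rkm; rewrite /r uij.
Qed.

End Rank.

(** * Base polytopes of submodular functions and their greedy vertices *)

Section BasePolytopes.
Set Implicit Arguments.
Unset Strict Implicit.
Unset Printing Implicit Defensive.
Variables (R : realType) (d : nat).
Implicit Types (I J : {set 'I_d}) (s : 'S_d) (z : {set 'I_d} -> R) (x : 'rV[R]_d).

Definition wt x I := \sum_(i in I) x 0 i.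

Definition initseg s (m : nat) := [set i : 'I_d | (s i < m)%N]%SET.

(* The greedy vertex of [z], where [s i] is the position of [i]. *)
Definition vtx s z : 'rV[R]_d :=
  \row_i (z (initseg s (s i).+1) - z (initseg s (s i))).

Definition base z : set 'rV[R]_d :=
  [set x | (forall I, wt x I <= z I) /\ wt x finset.setT = z finset.setT].

(** Submodularity in its local form, with two elements added to one set; [submod_gain] recovers
    diminishing marginal gains for arbitrary nested sets. *)
Definition submod z := z finset.set0 = 0 /\
  forall I a b, a \notin I -> b \notin I -> a != b ->
    z (a |: (b |: I))%SET + z I <= z (a |: I)%SET + z (b |: I)%SET.

Lemma wt0 x : wt x finset.set0 = 0.
Proof. by rewrite /wt big_set0. Qed.

Lemma wt1 x i : wt x [set i]%SET = x 0 i.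
Proof. by rewrite /wt big_set1. Qed.

Lemma wtU1 x i I : i \notin I -> wt x (i |: I)%SET = x 0 i + wt x I.
Proof. by move=> iI; rewrite /wt big_setU1. Qed.

Lemma wtD x y I : wt (x + y) I = wt x I + wt y I.
Proof. by rewrite /wt -big_split; apply: eq_bigr => i _; rewrite mxE. Qed.

Lemma wtZ c x I : wt (c *: x) I = c * wt x I.
Proof. by rewrite /wt mulr_sumr; apply: eq_bigr => i _; rewrite mxE. Qed.

Lemma wt_sum n (w : 'I_n -> R) (p : 'I_n -> 'rV[R]_d) I :
  wt (\sum_i w i *: p i) I = \sum_i w i * wt (p i) I.
Proof.
rewrite /wt; under eq_bigr do rewrite summxE.
rewrite exchange_big /=; apply: eq_bigr => k _.
by rewrite mulr_sumr; apply: eq_bigr => i _; rewrite mxE.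
Qed.

Lemma submodD z z' : submod z -> submod z' -> submod (z \+ z').
Proof.
move=> [z0 h] [z0' h']; split=> [|I a b aI bI ab] /=; first by rewrite z0 z0' addr0.
by have := h I a b aI bI ab; have := h' I a b aI bI ab; lra.
Qed.

Lemma submodZ c z : 0 <= c -> submod z -> submod (fun I => c * z I).
Proof.
move=> c0 [z0 h]; split=> [|I a b aI bI ab] /=; first by rewrite z0 mulr0.
by rewrite -!mulrDr ler_wpM2l // h.
Qed.

Lemma submod_sum (T : Type) (r : seq T) (P : pred T) (F : T -> {set 'I_d} -> R) :
  (forall t, P t -> submod (F t)) -> submod (fun I => \sum_(t <- r | P t) F t I).
Proof.
move=> h; split=> [|I a b aI bI ab].
  by rewrite big1 // => t Pt; have [] := h t Pt.
rewrite -!big_split /=; apply: ler_sum => t Pt.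
by have [_ ->] := h t Pt.
Qed.

Lemma submod_wt x : submod (wt x).
Proof.
split=> [|I a b aI bI ab]; first exact: wt0.
by rewrite !wtU1 ?in_setU1 ?negb_or ?ab //; lra.
Qed.

(** The set [I] grows to [J] one element at a time, and each addition can only lower the gain of
    [i]. *)
Lemma submod_gain z I J i : submod z -> I \subset J -> i \notin J ->
  z (i |: J)%SET - z J <= z (i |: I)%SET - z I.
Proof.
move=> [_ h]; move En : #|(J :\: I)%SET| => n.
elim: n I En => [|n IHn] I En IJ iJ.
  suff -> : I = J by [].
  by apply/eqP; rewrite finset.eqEsubset IJ -finset.setD_eq0 -cards_eq0 En.
have [j] : exists j, j \in (J :\: I)%SET by apply/set0Pn; rewrite -cards_eq0 En.
rewrite inE => /andP[jI jJ].
have iI : i \notin I by apply: contra iJ; apply: (fintype.subsetP IJ).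
have ij : i != j by apply: contraNneq iJ => ->.
have /IHn : #|(J :\: (j |: I))%SET| = n.
  rewrite [(j |: I)%SET]finset.setUC -finset.setDDl.
  by have := cardsD1 j (J :\: I); rewrite !inE jI jJ En => -[].
rewrite finset.subUset finset.sub1set jJ IJ => /(_ isT iJ).
by have := h I i j iI jI ij; lra.
Qed.

Lemma initseg_succ s m (md : (m < d)%N) (i := (s^-1)%g (Ordinal md)) :
  initseg s m.+1 = (i |: initseg s m)%SET /\ i \notin initseg s m.
Proof.
split; last by rewrite inE permKV ltnn.
apply/setP => j; rewrite !inE ltnS leq_eqVlt; congr (_ || _).
by rewrite -(inj_eq (@perm_inj _ s)) permKV.
Qed.

Lemma initseg_full s m : (d <= m)%N -> initseg s m = finset.setT.
Proof. by move=> dm; apply/setP => i; rewrite !inE (leq_trans _ dm). Qed.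

Lemma initseg0 s : initseg s 0 = finset.set0.
Proof. by apply/setP => i; rewrite !inE. Qed.

Lemma vtx_initseg s z m : z finset.set0 = 0 -> wt (vtx s z) (initseg s m) = z (initseg s m).
Proof.
move=> z0; elim: m => [|m IHm]; first by rewrite initseg0 wt0 z0.
case: (ltnP m d) => md; last by rewrite !initseg_full // in IHm *; rewrite ltnW.
have [e ni] := initseg_succ s md.
by rewrite e wtU1 // IHm mxE permKV /= -e subrK.
Qed.

(** The set [I] is built up in the order [s]. A new element weighs its gain over [initseg s m],
    which is at most its gain over the smaller set [I :&: initseg s m]. *)
Lemma vtx_le s z I : submod z -> wt (vtx s z) I <= z I.
Proof.
move=> hz; suff h m : wt (vtx s z) (I :&: initseg s m)%SET <= z (I :&: initseg s m)%SET.
  by have := h d; rewrite initseg_full // finset.setIT.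
elim: m => [|m IHm]; first by rewrite initseg0 finset.setI0 wt0 hz.1.
case: (ltnP m d) => md; last by rewrite !initseg_full // in IHm *; rewrite ltnW.
have [] := initseg_succ s md; set i := (s^-1)%g _ => e ni.
have [iI|iI] := boolP (i \in I); last first.
  suff -> : (I :&: initseg s m.+1 = I :&: initseg s m)%SET by [].
  apply/setP => j; rewrite e !inE; case: eqP => // ->.
  by rewrite (negPf iI).
have -> : (I :&: initseg s m.+1 = i |: (I :&: initseg s m))%SET.
  by apply/setP => j; rewrite e !inE; case: eqP => // ->; rewrite iI.
have niI : i \notin (I :&: initseg s m)%SET by rewrite inE negb_and ni orbT.
rewrite wtU1 // mxE permKV /= e.
by have := submod_gain hz (finset.subsetIr I (initseg s m)) ni; lra.
Qed.

Lemma base_vtx s z : submod z -> base z (vtx s z).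
Proof.
move=> hz; split=> [I|]; first exact: vtx_le.
by rewrite -(initseg_full s (leqnn d)) vtx_initseg // hz.1.
Qed.

Lemma rank_initseg (u : 'I_d -> R) s I :
  (forall i j, u j < u i -> (s i < s j)%N) ->
  (forall i j, i \in I -> j \notin I -> u j < u i) -> initseg s #|I| = I.
Proof.
move=> us uI; apply/setP => i; rewrite inE.
rewrite -(card_imset (mem I) (@perm_inj _ s)).
have cle (m : nat) : (m <= d)%N -> #|[set l : 'I_d | (l < m)%N]%SET| = m.
  move=> md; have wi : injective (widen_ord md).
    by move=> i1 i2 /(congr1 val) /= /val_inj.
  rewrite -[RHS]card_ord -(card_imset _ wi).
  apply: eq_card => l; rewrite !inE; apply/idP/imsetP => [lm|[k _ ->]] //=.
  by exists (Ordinal lm) => //; apply: val_inj.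
have [iI|iI] := boolP (i \in I).
  rewrite -(cle _ (ltn_ord (s i))); apply: subset_leq_card.
  apply/fintype.subsetP => l; rewrite inE ltnS => li.
  apply/imsetP; exists ((s^-1)%g l); last by rewrite permKV.
  apply: contraLR li => /(uI _ _ iI)/us; rewrite permKV.
  by rewrite -ltnNge.
apply/negbTE; rewrite -leqNgt -(cle _ (ltnW (ltn_ord (s i)))); apply: subset_leq_card.
by apply/fintype.subsetP => _ /imsetP[j jI ->]; rewrite inE us // uI.
Qed.

Lemma exists_flag I a b : a \notin I -> b \notin I -> a != b ->
  exists s, [/\ initseg s #|I| = I, initseg s #|I|.+1 = (a |: I)%SET
    & initseg s #|I|.+2 = (b |: (a |: I))%SET].
Proof.
move=> aI bI ab.
(* The values are 4 on [I], 2 at [a], 1 at [b] and 0 elsewhere, so sorting lists [I] first, then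
   [a], then [b]. *)
pose u i : R := (2 * (i \in I) + (i \in a |: I) + (i \in b |: (a |: I)))%N%:R.
have [s us] := rank_perm u.
have bai : b \notin a |: I by rewrite !inE eq_sym (negPf ab).
exists s; split.
- apply: (rank_initseg us) => i j iI jI; rewrite ltr_nat !inE iI (negPf jI) !orbT.
  by case: (j == a); case: (j == b).
- have -> : #|I|.+1 = #|(a |: I)%SET| by rewrite cardsU1 aI.
  apply: (rank_initseg us) => i j; rewrite !inE ltr_nat !inE.
  by case: (i == a); case: (j == a); case: (j == b); case: (i == b);
    case: (i \in I); case: (j \in I).
- have -> : #|I|.+2 = #|(b |: (a |: I))%SET| by rewrite cardsU1 bai cardsU1 aI.
  apply: (rank_initseg us) => i j; rewrite !inE ltr_nat !inE.
  by case: (i == a); case: (j == a); case: (j == b); case: (i == b);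
    case: (i \in I); case: (j \in I).
Qed.

Lemma exists_initseg I : exists s, initseg s #|I| = I.
Proof.
have [s us] := rank_perm (fun i => (i \in I)%:R : R); exists s.
by apply: (rank_initseg us) => i j iI /negPf jI; rewrite iI jI ltr_nat.
Qed.

(* Abel summation along the order [s] that sorts [u]. *)
Lemma dot_le_vtx (u : 'rV[R]_d) x z s : z finset.set0 = 0 -> base z x ->
  (forall i j, u 0 j < u 0 i -> (s i < s j)%N) -> dot u x <= dot u (vtx s z).
Proof.
move=> z0 [xz xT] us; pose w := vtx s z - x.
have wp m : 0 <= wt w (initseg s m).
  by rewrite wtD -scaleN1r wtZ vtx_initseg //; have := xz (initseg s m); lra.
suff h m c : (forall i, (s i < m)%N -> c <= u 0 i) ->
    c * wt w (initseg s m) <= \sum_(i in initseg s m) u 0 i * w 0 i.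
  (* Any lower bound of [u] will do here: it is multiplied by the total weight of [w], which is
     0. *)
  have c0 i : (s i < d)%N -> - (\sum_j `|u 0 j|) <= u 0 i.
    move=> _; rewrite (bigD1 i) //=.
    have : 0 <= \sum_(j | j != i) `|u 0 j| by apply: sumr_ge0.
    by have := ler_norm (- u 0 i); rewrite normrN; lra.
  have := h d _ c0; rewrite initseg_full //.
  have -> : wt w finset.setT = 0.
    rewrite wtD -scaleN1r wtZ -(initseg_full s (leqnn d)) vtx_initseg //.
    by rewrite initseg_full // xT; lra.
  rewrite mulr0; set S := \sum_(i in _) _.
  have -> : S = dot u (vtx s z) - dot u x; last by rewrite subr_ge0.
  rewrite /S /dot -sumrB big_mkcond; apply: eq_bigr => i _.
  by rewrite inE !mxE; ring.
elim: m c => [|m IHm] c hc; first by rewrite initseg0 wt0 big_set0 mulr0.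
case: (ltnP m d) => md; last first.
  rewrite !initseg_full // in IHm *; last by rewrite ltnW.
  by apply: IHm => i _; apply: hc; rewrite (leq_trans (ltn_ord _)) // ltnW.
have [] := initseg_succ s md; set i := (s^-1)%g _ => e ni.
have si : s i = m :> nat by rewrite permKV.
rewrite e big_setU1 //= -e; have W := wp m.+1.
have cu : c <= u 0 i by apply: hc; rewrite si.
(* Since [w] has nonnegative weight on the segment, [c] may be raised to [u 0 i], the least value of
   [u] there; the term of [i] then cancels. *)
apply: le_trans (ler_wpM2r W cu) _.
rewrite e wtU1 // mulrDr lerD2l; apply: IHm => j jm.
by rewrite leNgt; apply/negP => /us; rewrite si ltnNge ltnW.
Qed.

(** No direction [u] separates [x] from the greedy vertices: the vertex whose order sorts [u] does
    at least as well as [x]. *)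
Lemma base_sub_conv z x : z finset.set0 = 0 -> base z x ->
  conv (range (fun s => vtx s z)) x.
Proof.
move=> z0 xz; apply: conv_of_separation => u.
have [s us] := rank_perm (fun i => u 0 i); exists s.
exact: dot_le_vtx.
Qed.

(** Convexity, phrased with the same finite families as [conv]. *)
Definition mean_closed (C : set 'rV[R]_d) := forall n (w : 'I_n -> R) (p : 'I_n -> 'rV[R]_d),
  (forall i, 0 <= w i) -> \sum_i w i = 1 -> (forall i, C (p i)) ->
  C (\sum_i w i *: p i).

Lemma conv_min (A C : set 'rV[R]_d) : mean_closed C -> A `<=` C -> conv A `<=` C.
Proof. by move=> hC sAC x [n [w [p [w0 w1 pA ->]]]]; apply: hC => // i; apply: sAC. Qed.

Lemma mean_closed_conv (A : set 'rV[R]_d) : mean_closed (conv A).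
Proof. by move=> n w p *; apply: conv_sum. Qed.

Lemma mean_closed_base z : mean_closed (base z).
Proof.
move=> n w p w0 w1 pz; split=> [I|].
  rewrite wt_sum -[leRHS]mul1r -w1 mulr_suml; apply: ler_sum => i _.
  by rewrite ler_wpM2l //; have [] := pz i.
rewrite wt_sum -[RHS]mul1r -w1 mulr_suml; apply: eq_bigr => i _.
by have [_ ->] := pz i.
Qed.

Lemma mean_closed_add (A B : set 'rV[R]_d) :
  mean_closed A -> mean_closed B -> mean_closed (mink_add A B).
Proof.
move=> hA hB n w p w0 w1 /= pAB.
have /choice [q hq] : forall i, exists q : 'rV[R]_d * 'rV[R]_d,
    [/\ A q.1, B q.2 & p i = q.1 + q.2].
  by move=> i; have [a Aa [b Bb <-]] := pAB i; exists (a, b).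
exists (\sum_i w i *: (q i).1); first by apply: hA => // i; have [] := hq i.
exists (\sum_i w i *: (q i).2); first by apply: hB => // i; have [] := hq i.
rewrite -big_split; apply: eq_bigr => i _ /=.
by have [_ _ ->] := hq i; rewrite scalerDr.
Qed.

Lemma mean_closed_dilate c (A : set 'rV[R]_d) : mean_closed A -> mean_closed (dilate c A).
Proof.
move=> hA n w p w0 w1 /= pA.
have /choice [q hq] : forall i, exists q, A q /\ p i = c *: q.
  by move=> i; have [a Aa <-] := pA i; exists a.
exists (\sum_i w i *: q i); first by apply: hA => // i; have [] := hq i.
rewrite scaler_sumr; apply: eq_bigr => i _ /=.
by have [_ ->] := hq i; rewrite !scalerA mulrC.
Qed.

Lemma base_convE z : submod z -> base z = conv (range (fun s => vtx s z)).
Proof.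
move=> hz; apply/seteqP; split=> [x|]; first by apply: base_sub_conv; case: hz.
by apply: conv_min; [exact: mean_closed_base | move=> _ [s _ <-]; apply: base_vtx].
Qed.

Lemma base_polytope z : submod z -> polytope (base z).
Proof.
move=> hz; exists (range (fun s => vtx s z)); last exact: base_convE.
by apply: finite_image; exact: finite_finset.
Qed.

Lemma vtxD s z z' : vtx s (z \+ z') = vtx s z + vtx s z'.
Proof. by apply/rowP => i; rewrite !mxE /=; ring. Qed.

Lemma vtxZ s c z : vtx s (fun I => c * z I) = c *: vtx s z.
Proof. by apply/rowP => i; rewrite !mxE /=; ring. Qed.

(** The inclusion of the right side needs checking at greedy vertices only, and for a fixed order
    the greedy vertex is additive in the set function. *)
Lemma base_add z z' : submod z -> submod z' ->
  mink_add (base z) (base z') = base (z \+ z').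
Proof.
move=> hz hz'; apply/seteqP; split=> [_ [x [xz xT] [y [yz yT] <-]]|].
  by split=> [I|]; rewrite wtD ?xT ?yT //= lerD.
rewrite (base_convE (submodD hz hz')); apply: conv_min.
  by apply: mean_closed_add; exact: mean_closed_base.
move=> _ [s _ <-]; rewrite vtxD; exists (vtx s z); first exact: base_vtx.
by exists (vtx s z') => //; exact: base_vtx.
Qed.

Lemma base_dilate c z : 0 <= c -> submod z ->
  dilate c (base z) = base (fun I => c * z I).
Proof.
move=> c0 hz; apply/seteqP; split=> [_ [x [xz xT] <-]|].
  by split=> [I|]; rewrite wtZ ?xT // ler_wpM2l.
rewrite (base_convE (submodZ c0 hz)); apply: conv_min.
  by apply: mean_closed_dilate; exact: mean_closed_base.
by move=> _ [s _ <-]; rewrite vtxZ; exists (vtx s z) => //; exact: base_vtx.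
Qed.

Lemma base_translate z t : translate (base z) t = base (z \+ wt t).
Proof.
apply/seteqP; split=> [_ [x [xz xT] <-]|x [xz xT]].
  by split=> [I|]; rewrite wtD /= ?xT // lerD2r.
exists (x - t); last by rewrite subrK.
have e I : wt (x - t) I = wt x I - wt t I by rewrite wtD -scaleN1r wtZ mulN1r.
split=> [I|]; rewrite e; first by rewrite lerBlDr; exact: xz.
by rewrite xT /= addrK.
Qed.

Lemma wt_col_perm s x I : wt (col_perm s x) I = wt x [set s i | i in I]%SET.
Proof.
rewrite /wt big_imset /=; last by move=> i j _ _; apply: perm_inj.
by apply: eq_bigr => i _; rewrite mxE.
Qed.

Lemma base_permute s z : permute s (base z) = base (fun I => z [set s i | i in I]%SET).
Proof.
have sT (t : 'S_d) : [set t i | i in [set: 'I_d]%SET]%SET = finset.setT.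
  apply/setP => i; rewrite [RHS]inE; apply/imsetP; exists ((t^-1)%g i) => //.
  by rewrite permKV.
apply/seteqP; split=> [_ [x [xz xT] <-]|x [xz xT]].
  by split=> [I|]; rewrite wt_col_perm // sT xT.
exists (col_perm s^-1 x); last by rewrite -col_permM mulgV col_perm1.
split=> [I|]; rewrite wt_col_perm; last by rewrite sT xT sT.
apply: le_trans (xz _) _; rewrite -imset_comp.
by rewrite (eq_imset _ (g := id)) ?imset_id // => i /=; rewrite permKV.
Qed.

Lemma submod_perm s z : submod z -> submod (fun I => z [set s i | i in I]%SET).
Proof.
move=> [z0 h]; split=> [|I a b aI bI ab]; first by rewrite imset0.
rewrite !imsetU1; apply: h; last by rewrite (inj_eq perm_inj).
- by rewrite (mem_imset _ _ (@perm_inj _ s)).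
- by rewrite (mem_imset _ _ (@perm_inj _ s)).
Qed.

(** The support function of [P] in the directions of indicator vectors. *)
Definition zof (P : set 'rV[R]_d) I := sup [set wt x I | x in P].

(** The bound [z I] is attained at a greedy vertex whose order starts with [I]. *)
Lemma zof_base z : submod z -> zof (base z) = z.
Proof.
move=> hz; apply: funext => I; have [s sI] := exists_initseg I.
apply/eqP; rewrite eq_le; apply/andP; split.
  apply: ge_sup => [|_ [x [xz _] <-]]; last exact: xz.
  by exists (wt (vtx s z) I); exists (vtx s z) => //; exact: base_vtx.
apply: ub_le_sup; first by exists (z I) => _ [x [xz _] <-].
exists (vtx s z); first exact: base_vtx.
by rewrite -sI vtx_initseg //; case: hz.
Qed.

End BasePolytopes.

(** * Generalized permutahedra are the base polytopes of submodular functions *)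

Section GenPerm.
Set Implicit Arguments.
Unset Strict Implicit.
Unset Printing Implicit Defensive.
Variables (R : realType) (d : nat).
Implicit Types (I J : {set 'I_d}) (s : 'S_d) (z : {set 'I_d} -> R) (x : 'rV[R]_d).

Lemma card_initseg s m : (m <= d)%N -> #|initseg s m| = m.
Proof.
elim: m => [|m IHm] md; first by rewrite initseg0 cards0.
have [-> ni] := initseg_succ s md.
by rewrite cardsU1 ni IHm // ltnW.
Qed.

(** The sum of the [#|I|] largest numbers among 1, ..., d, hence the support function of the
    permutahedron. *)
Definition zperm I : R := \sum_(l < #|I|) (d%:R - l%:R).

Lemma zperm_local I a b : a \notin I -> b \notin I -> a != b ->
  zperm (a |: I)%SET + zperm (b |: I)%SET = zperm (a |: (b |: I))%SET + zperm I + 1.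
Proof.
move=> aI bI ab; rewrite /zperm !cardsU1 !inE aI bI (negPf ab) (negPf aI) /=.
by rewrite !big_ord_recr /= -natr1; ring.
Qed.

Lemma submod_zperm : submod zperm.
Proof.
split=> [|I a b aI bI ab]; first by rewrite /zperm cards0 big_ord0.
by rewrite zperm_local //; lra.
Qed.

Lemma vtx_zperm s i : vtx s zperm 0 i = d%:R - (s i)%:R.
Proof.
rewrite mxE /zperm !card_initseg ?(ltnW (ltn_ord (s i))) //.
by rewrite big_ord_recr /=; ring.
Qed.

Lemma permutahedronE : permutahedron R d = base zperm.
Proof.
rewrite (base_convE submod_zperm) /permutahedron; congr conv.
(* A greedy vertex has coordinates [d - s i]; reversing the positions turns them into [(s i).+1]. *)
have E s : \row_i (s i).+1%:R = vtx (s * perm (@rev_ord_inj d))%g zperm.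
  apply/rowP => i; rewrite vtx_zperm mxE permM permE /=.
  by rewrite natrB //; ring.
apply/seteqP; split=> [_ [s _ <-]|_ [s _ <-]].
  by rewrite E; exists (s * perm (@rev_ord_inj d))%g.
exists (s * (perm (@rev_ord_inj d))^-1)%g => //.
by rewrite E mulgKV.
Qed.

(** All submodularity gaps of [zperm] equal 1 by [zperm_local], so [l * zperm - z] is submodular as
    soon as [l] bounds the gaps of [z]; its base polytope is the complementary summand. *)
Lemma genperm_of_submod z : submod z -> genperm (base z).
Proof.
move=> hz; split; first exact: base_polytope.
pose gap I a b := z (a |: I)%SET + z (b |: I)%SET - z (a |: (b |: I))%SET - z I.
pose l := 1 + \sum_I \sum_a \sum_b `|gap I a b|.
have gl I a b : gap I a b <= l.
  have h1 : `|gap I a b| <= \sum_b `|gap I a b|.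
    by rewrite (bigD1 b) //= lerDl sumr_ge0.
  have h2 : \sum_b `|gap I a b| <= \sum_a \sum_b `|gap I a b|.
    by rewrite [leRHS](bigD1 a) //= lerDl; do 2!apply: sumr_ge0 => ? _.
  have h3 : \sum_a \sum_b `|gap I a b| <= \sum_I \sum_a \sum_b `|gap I a b|.
    by rewrite [leRHS](bigD1 I) //= lerDl; do 3!apply: sumr_ge0 => ? _.
  have := ler_norm (gap I a b); rewrite /l; lra.
have l0 : 0 < l.
  rewrite ltr_pwDl // ?ltr01 //.
  by do 3!apply: sumr_ge0 => ? _.
exists l => //.
have hw : submod (fun I => l * zperm I - z I).
  split=> [|I a b aI bI ab]; first by rewrite hz.1 submod_zperm.1; ring.
  have := zperm_local aI bI ab; have := gl I a b; rewrite /gap.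
  set A := zperm _; set B := zperm _; set C := zperm _; set D := zperm _ => h e.
  have : l * A + l * B = l * C + l * D + l by rewrite -!mulrDr e; ring.
  lra.
exists (base (fun I => l * zperm I - z I)); first exact: base_polytope.
rewrite base_add // permutahedronE base_dilate ?ltW //; last exact: submod_zperm.
by congr base; apply: funext => I /=; ring.
Qed.

(* A vertex of [l Pi] splits as [p + q] with [p] in [P] and [q] in [Q]; the
   inequalities [wt p <= zof P] and [wt q <= zof Q] are then equalities along
   the corresponding flag, so [p] is the greedy vertex of [zof P]. *)
Lemma genperm_zof (P : set 'rV[R]_d) : genperm P -> submod (zof P) /\ P = base (zof P).
Proof.
move=> [[A _ PA] [l l0 [Q _]]].
rewrite permutahedronE base_dilate ?ltW //; last exact: submod_zperm.
set z := fun I => _ => PQ; have hz : submod z by apply: submodZ (ltW l0) submod_zperm.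
have PQz x y : P x -> Q y -> base z (x + y).
  by move=> Px Qy; rewrite -PQ; exists x => //; exists y.
have [p0 Pp0 [q0 Qq0 _]] : mink_add P Q (vtx 1%g z) by rewrite PQ; apply: base_vtx.
have hasP I : has_sup [set wt x I | x in P].
  split; first by exists (wt p0 I); exists p0.
  exists (z I - wt q0 I) => _ [x Px <-].
  by have [h _] := PQz _ _ Px Qq0; have := h I; rewrite wtD; lra.
have hasQ I : has_sup [set wt x I | x in Q].
  split; first by exists (wt q0 I); exists q0.
  exists (z I - wt p0 I) => _ [x Qx <-].
  by have [h _] := PQz _ _ Pp0 Qx; have := h I; rewrite wtD; lra.
have zE I : zof P I + zof Q I = z I.
  rewrite -(zof_base hz) -PQ /zof -sup_sumE //; congr sup.
  apply/seteqP; split=> [_ [_ [x Px <-] [_ [y Qy <-] <-]]|_ [_ [x Px [y Qy <-]] <-]].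
    by rewrite -wtD; exists (x + y) => //; exists x => //; exists y.
  by rewrite wtD; exists (wt x I); [exists x | exists (wt y I) => //; exists y].
have leP x I : P x -> wt x I <= zof P I.
  by move=> Px; apply: ub_le_sup; [case: (hasP I) | exists x].
have leQ x I : Q x -> wt x I <= zof Q I.
  by move=> Qx; apply: ub_le_sup; [case: (hasQ I) | exists x].
have z0 : zof P finset.set0 = 0.
  rewrite /zof (_ : [set _ | x in P] = [set 0]) ?sup1 //.
  by apply/seteqP; split=> [_ [x _ <-]|_ ->]; [rewrite wt0 | exists p0; rewrite ?wt0].
have Pvtx s : P (vtx s (zof P)).
  have [p Pp [q Qq pq]] : mink_add P Q (vtx s z) by rewrite PQ; apply: base_vtx.
  have E m : wt p (initseg s m) = zof P (initseg s m).
    have := leP p (initseg s m) Pp; have := leQ q (initseg s m) Qq.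
    have := zE (initseg s m); rewrite -(vtx_initseg s m hz.1) -pq wtD; lra.
  suff -> : vtx s (zof P) = p by [].
  apply/rowP => i; rewrite mxE -!E.
  have [] := initseg_succ s (ltn_ord (s i)).
  rewrite (_ : (s^-1)%g _ = i); last by apply: (@perm_inj _ s); rewrite permKV; apply: val_inj.
  by move=> e ni; rewrite e wtU1 //; ring.
have hP : submod (zof P).
  split=> // I a b aI bI ab.
  (* The greedy vertex of the flag [I], [a |: I], [b |: (a |: I)] lies in [P]. Its weight on
     [b |: I] is the value at the top, minus that at [a |: I], plus that at [I], and is at most
     [zof P (b |: I)]. *)
  have [s [e1 e2 e3]] := exists_flag R aI bI ab.
  have := leP _ (b |: I)%SET (Pvtx s); rewrite wtU1 //.
  have := vtx_initseg s #|I|.+2 z0; rewrite e3 wtU1; last by rewrite !inE eq_sym (negPf ab).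
  rewrite -e2 vtx_initseg // e2 -e1 vtx_initseg // e1 finset.setUCA; lra.
split=> //; apply/seteqP; split=> [x Px|].
  split=> [I|]; first exact: leP.
  apply/eqP; rewrite eq_le leP //=.
  apply: ge_sup => [|_ [y Py <-]]; first by exists (wt p0 finset.setT); exists p0.
  (* Both [x + q0] and [y + q0] have total weight [z finset.setT], so the total weight is constant
     on [P]. *)
  have [_] := PQz x q0 Px Qq0; have [_] := PQz y q0 Py Qq0.
  by rewrite !wtD; lra.
rewrite (base_convE hP); apply: conv_min.
  by rewrite PA; exact: mean_closed_conv.
by move=> _ [s _ <-].
Qed.

(** The support function of the simplex on [J]; for empty [J] it is 0, matching the point 0. *)
Definition zsimplex J I : R := (I :&: J != finset.set0)%SET%:R.

Lemma submod_zsimplex J : submod (zsimplex J).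
Proof.
split=> [|I a b aI bI ab]; first by rewrite /zsimplex finset.set0I eqxx.
have E i K : (((i |: K) :&: J) != finset.set0)%SET = (i \in J) || ((K :&: J) != finset.set0)%SET.
  rewrite finset.setIUl finset.setU_eq0 negb_and; congr (_ || _).
  apply/set0Pn/idP => [[k]|iJ]; last by exists i; rewrite !inE eqxx.
  by rewrite !inE => /andP[/eqP->].
rewrite /zsimplex !E -!natrD ler_nat.
by case: (a \in J); case: (b \in J); case: (_ != _).
Qed.

Lemma simplexE J : @simplex R d J = base (zsimplex J).
Proof.
have z1 I : zsimplex J I <= 1 by rewrite /zsimplex lern1; case: (_ != _).
have ge0 x i : base (zsimplex J) x -> 0 <= x 0 i.
  move=> [xz]; rewrite -(finset.setUCr [set i]%SET) wtU1; last by rewrite !inE eqxx.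
  have := xz (~: [set i])%SET; rewrite finset.setUCr.
  have [J0|J0] := eqVneq J finset.set0.
    by rewrite /zsimplex J0 !finset.setI0 eqxx; lra.
  by have := z1 (~: [set i])%SET; rewrite {3}/zsimplex finset.setTI J0 /=; lra.
have le0 x i : base (zsimplex J) x -> i \notin J -> x 0 i = 0.
  move=> xz iJ; apply/eqP; rewrite eq_le ge0 // andbT -wt1.
  apply: le_trans (xz.1 _) _; rewrite /zsimplex (_ : _ :&: _ = finset.set0)%SET ?eqxx //.
  apply/setP => j; rewrite !inE; apply/negP => /andP[/eqP-> jJ].
  by rewrite jJ in iJ.
rewrite /simplex; case: eqVneq => [J0|/set0Pn[j0 j0J]].
  apply/seteqP; split=> [_ ->|x xz].
    have w0 I : wt (0 : 'rV[R]_d) I = 0 by rewrite /wt big1 // => i _; rewrite mxE.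
    by split=> [I|]; rewrite w0 ?ler0n // /zsimplex J0 finset.setI0 eqxx.
  by apply/rowP => i; rewrite mxE le0 // J0 inE.
have zT : zsimplex J finset.setT = 1.
  by rewrite /zsimplex finset.setTI (_ : J != finset.set0) //; apply/set0Pn; exists j0.
apply/seteqP; split; last first.
  move=> x xz.
  (* Off [J] the coordinates vanish, so any vertex may stand there; [j0] keeps all points inside the
     simplex. *)
  have -> : x = \sum_i x 0 i *: delta_mx 0 (if i \in J then i else j0).
    rewrite [LHS]row_sum_delta; apply: eq_bigr => i _.
    by case: ifPn => // /(le0 _ _ xz) ->; rewrite !scale0r.
  apply: conv_fin => [i||i]; first exact: ge0.
    by rewrite -zT -xz.2 /wt; apply: eq_bigl => i; rewrite inE.
  by case: ifPn => [iJ|_]; [exists i | exists j0].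
apply: conv_min; first exact: mean_closed_base.
have wtd i I : wt (delta_mx 0 i : 'rV[R]_d) I = (i \in I)%:R.
  rewrite /wt; have [iI|iI] := boolP (i \in I).
    rewrite (bigD1 i) //= mxE !eqxx big1 ?addr0 // => k /andP[_ ki].
    by rewrite mxE (negPf ki) andbF.
  rewrite big1 // => k kI; rewrite mxE; case: eqP => // _; case: eqP => // ki.
  by rewrite -ki kI in iI.
move=> _ [i /= iJ <-]; split=> [I|]; last by rewrite wtd inE zT.
rewrite wtd /zsimplex ler_nat; case: (boolP (i \in I)) => // iI.
rewrite lt0b; apply/set0Pn; exists i; rewrite inE iI /=; exact: iJ.
Qed.

End GenPerm.

(** * Symmetrization, level sums and their second differences *)

Section LevelSums.
Set Implicit Arguments.
Unset Strict Implicit.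
Unset Printing Implicit Defensive.
Variables (R : realType) (d : nat).
Implicit Types (I J : {set 'I_d}) (s : 'S_d) (z : {set 'I_d} -> R) (x : 'rV[R]_d).

(** For [m <= d] this is [d!] times the mean of [z] over the sets of size [m]. *)
Definition level (m : nat) z := \sum_(s : 'S_d) z (initseg s m).

(** Minus the second difference of the level sums, centred at [m.+1]. *)
Definition curv (m : nat) z := 2 * level m.+1 z - level m z - level m.+2 z.

Lemma level_linear m a b z z' :
  level m (fun I => a * z I + b * z' I) = a * level m z + b * level m z'.
Proof. by rewrite /level big_split -!mulr_sumr. Qed.

Lemma curv_linear m a b z z' :
  curv m (fun I => a * z I + b * z' I) = a * curv m z + b * curv m z'.
Proof. by rewrite /curv !level_linear; ring. Qed.

(* Reindexing half of the middle term by the transposition of the positions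
   [m] and [m.+1] turns [curv m z] into a sum of local submodularity gaps. *)
Lemma curv_ge0 m z : (m.+2 <= d)%N -> submod z -> 0 <= curv m z.
Proof.
move=> md [_ hz]; have m1d := ltnW md.
pose a := Ordinal m1d; pose b := Ordinal md.
have E : curv m z = \sum_(s : 'S_d) (z (initseg s m.+1) + z (initseg (s * tperm a b)%g m.+1)
    - z (initseg s m) - z (initseg s m.+2)).
  rewrite !sumrB big_split /= /curv mulrDl !mul1r; congr (_ + _ - _ - _).
  by rewrite /level (reindex_inj (mulIg (tperm a b))).
rewrite E; apply: sumr_ge0 => s _.
have [] := initseg_succ s m1d; have [] := initseg_succ s md.
have [] := initseg_succ (s * tperm a b)%g m1d.
rewrite -/a -/b invMg tpermV permM tpermL.
(* Exchanging the positions [m] and [m.+1] does not affect the positions below [m]. *)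
have -> : initseg (s * tperm a b)%g m = initseg s m.
  apply/setP => i; rewrite !inE permM; case: tpermP => [->|->|] //=.
    by rewrite ltnn; lia.
  by rewrite ltnn; lia.
set i := (s^-1)%g a; set j := (s^-1)%g b.
move=> -> jI e2; rewrite e2 => + e1; rewrite e1 => ji iI.
have ij : i != j by apply: contraNneq ji => <-; rewrite !inE eqxx.
by have := hz (initseg s m) i j iI jI ij; rewrite finset.setUCA; lra.
Qed.

(** Both [wt x] and its negative [wt (- x)] are submodular, so their curvatures, opposite by
    linearity, are both nonnegative. *)
Lemma curv_wt m x : (m.+2 <= d)%N -> curv m (wt x) = 0.
Proof.
move=> md; have h := curv_ge0 md (submod_wt x).
have := curv_ge0 md (submod_wt (- x)).
have -> : wt (- x) = (fun I => -1 * wt x I + 0 * wt x I).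
  by apply: funext => I; rewrite -scaleN1r wtZ mul0r addr0.
by rewrite curv_linear; lra.
Qed.

Lemma initseg_imset s t m :
  [set s i | i in initseg t m]%SET = initseg (s^-1 * t)%g m.
Proof.
apply/setP => i; rewrite inE permM; apply/imsetP/idP => [[j jt ->]|h].
  by move: jt; rewrite inE permK.
by exists ((s^-1)%g i); rewrite ?inE // permKV.
Qed.

(** Some permutation makes [I] an initial segment, and translation in the group then absorbs it; so
    the sum depends on [I] through its size only. *)
Lemma sum_imset_perm z I : \sum_(s : 'S_d) z [set s i | i in I]%SET = level #|I| z.
Proof.
have [t {1}<-] := exists_initseg R I; set m := #|I|.
rewrite /level [RHS](reindex_inj (mulIg t)) /= [RHS](reindex_inj invg_inj) /=.
by apply: eq_bigr => s _; rewrite initseg_imset.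
Qed.

Lemma level_perm m s z : level m (fun I => z [set s i | i in I]%SET) = level m z.
Proof.
rewrite /level [RHS](reindex_inj (mulgI s^-1)%g).
by apply: eq_bigr => t _; rewrite initseg_imset.
Qed.

Lemma curv_perm m s z : curv m (fun I => z [set s i | i in I]%SET) = curv m z.
Proof. by rewrite /curv !level_perm. Qed.

(* [base (zhyper j)] is the [j]-th hypersimplex. *)
Definition zhyper (j : nat) I : R := (minn #|I| j)%:R.

Lemma submod_zhyper j : submod (zhyper j).
Proof.
split=> [|I a b aI bI ab]; first by rewrite /zhyper cards0 min0n.
rewrite /zhyper !cardsU1 !inE aI bI (negPf ab) (negPf aI) -!natrD ler_nat /=; lia.
Qed.

Lemma level_zhyper m j : (m <= d)%N -> level m (zhyper j) = d`!%:R * (minn m j)%:R.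
Proof.
move=> md; rewrite /level (eq_bigr (fun=> (minn m j)%:R)).
  by rewrite sumr_const mulr_natl; congr (_ *+ _); exact: card_Sn.
by move=> s _; rewrite /zhyper card_initseg.
Qed.

(** The function [minn m j.+1] of [m] is linear on either side of its single kink, at [j.+1]. *)
Lemma curv_zhyper m j : (m.+2 <= d)%N -> curv m (zhyper j.+1) = (m == j)%:R * d`!%:R.
Proof.
move=> md; rewrite /curv !level_zhyper //; [|lia|lia].
have -> : (m == j)%:R = 2 * (minn m.+1 j.+1)%:R - (minn m j.+1)%:R - (minn m.+2 j.+1)%:R :> R.
  have [mj|mj|->] := ltngtP m j.
  - by rewrite !(minn_idPl _) /= -?natr1; [ring|lia|lia|lia].
  - by rewrite !(minn_idPr _) /=; [ring|lia|lia|lia].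
  - rewrite (minn_idPl (leqnn _)) (minn_idPl (leqnSn _)) (minn_idPr (leqnSn _)).
    by rewrite -natr1 /=; ring.
ring.
Qed.

(** A discrete Taylor formula from the right end: a linear function with the last slope, plus one
    kink at each interior point [j.+1]. *)
Lemma second_difference_sum (g : nat -> R) n m : g 0 = 0 -> (m <= n.+1)%N ->
  g m = m%:R * (g n.+1 - g n) +
    \sum_(0 <= j < n) (2 * g j.+1 - g j - g j.+2) * (minn m j.+1)%:R.
Proof.
move=> g0; elim: n m => [|n IHn] m mn.
  rewrite big_geq // addr0; case: m mn => [|[|]] // _; rewrite g0; ring.
rewrite big_nat_recr //=; have [m1|] := leqP m n.+1.
  by rewrite {1}(IHn m m1); ring.
move=> m2; have {mn m2} -> : m = n.+2 by lia.
(* The new endpoint is reached from the hypothesis at [n.+1]: the kinks with [j < n] lie below both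
   points, so the minima agree. *)
have := IHn n.+1 (leqnn _).
rewrite (eq_big_nat _ _ (F2 := fun j => (2 * g j.+1 - g j - g j.+2) * (minn n.+2 j.+1)%:R)).
  by set S := \sum_(_ <= _ < _) _; rewrite -!natr1; lra.
by move=> j /andP[_ jn]; congr (_ * _%:R); lia.
Qed.

Lemma symmetrization z I : submod z ->
  \sum_(s : 'S_d) z [set s i | i in I]%SET =
  wt (const_mx (level d z - level d.-1 z)) I
  + \sum_(0 <= j < d.-1) curv j z * zhyper j.+1 I.
Proof.
move=> hz; rewrite sum_imset_perm.
have l0 : level 0 z = 0.
  by rewrite /level big1 // => s _; rewrite initseg0 hz.1.
have Id : (#|I| <= d)%N by rewrite -[X in (_ <= X)%N]card_ord max_card.
have -> : wt (const_mx (level d z - level d.-1 z)) I = #|I|%:R * (level d z - level d.-1 z).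
  rewrite /wt (eq_bigr (fun=> level d z - level d.-1 z)); last by move=> i _; rewrite mxE.
  by rewrite sumr_const mulr_natl.
have [d0|dp] := posnP d.
  have -> : #|I| = 0%N by lia.
  by rewrite l0 mul0r big_geq ?addr0 // d0.
rewrite (second_difference_sum (g := fun m => level m z) l0 (n := d.-1)); last by rewrite prednK.
by rewrite prednK.
Qed.

(* Double counting of the pairs ([s], [I]) with [#|I| = m]. *)
Lemma level_draws m z : (m <= d)%N ->
  'C(d, m)%:R * level m z = d`!%:R * \sum_(I : {set 'I_d} | #|I| == m) z I.
Proof.
move=> md.
have -> : 'C(d, m)%:R * level m z =
    \sum_(I : {set 'I_d} | #|I| == m) \sum_(s : 'S_d) z [set s i | i in I]%SET.
  rewrite (eq_bigr (fun=> level m z)); last by move=> I /eqP <-; rewrite sum_imset_perm.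
  rewrite sumr_const mulr_natl; congr (_ *+ _).
  by have := card_draws 'I_d m; rewrite card_ord => <-; apply: eq_card => I; rewrite !inE.
rewrite exchange_big /= (eq_bigr (fun=> \sum_(I : {set 'I_d} | #|I| == m) z I)).
  by rewrite sumr_const mulr_natl; congr (_ *+ _); exact: card_Sn.
move=> s _; rewrite [RHS](reindex_inj (imset_inj (@perm_inj _ s))) /=.
by apply: eq_bigl => I; rewrite card_imset //; exact: perm_inj.
Qed.

(** The sets of size [m] on which [zsimplex R J] vanishes are the [m]-subsets of the complement of
    [J]. *)
Lemma level_zsimplex m J : (m <= d)%N ->
  level m (zsimplex R J) = d`!%:R - (m`! * (d - m)`!)%:R * 'C(d - #|J|, m)%:R.
Proof.
move=> md; have c0 : 'C(d, m)%:R != 0 :> R by rewrite pnatr_eq0 -lt0n bin_gt0.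
apply: (mulfI c0); rewrite level_draws // mulrBr.
have -> : \sum_(I : {set 'I_d} | #|I| == m) zsimplex R J I
    = 'C(d, m)%:R - 'C(d - #|J|, m)%:R.
  have <- : #|(~: J)%SET| = (d - #|J|)%N by rewrite cardsCs finset.setCK card_ord.
  have := card_draws 'I_d m; rewrite card_ord => <-.
  rewrite -cards_draws -!sum1_card !natr_sum.
  rewrite [X in _ = X - _](eq_bigl (fun I : {set 'I_d} => #|I| == m));
    last by move=> I; rewrite inE.
  rewrite [X in _ - X](eq_bigl (fun I : {set 'I_d} => (#|I| == m) && (I \subset ~: J)%SET));
    last by move=> I; rewrite inE andbC.
  rewrite [X in _ - X]big_mkcondr -sumrB; apply: eq_bigr => I _.
  rewrite /zsimplex finset.setI_eq0 finset.disjoints_subset.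
  by case: ifP => _ /=; ring.
rewrite [in RHS]mulrA -(natrM _ 'C(d, m) (m`! * (d - m)`!)) bin_fact //; ring.
Qed.

(** The [d!] terms cancel in the second difference. With [e = d - n] and [E = e - m], the three
    remaining binomials are multiples of ['C(e, m)], and their combination factors through
    [n * (n - 1)]. *)
Lemma curv_zsimplex m k J : d = (m + k.+2)%N ->
  curv m (zsimplex R J) = (2 * m`! * k`!)%:R * ('C(#|J|, 2) * 'C(d - #|J|, m))%:R.
Proof.
move=> dE; have Jd : (#|J| <= d)%N by rewrite -[X in (_ <= X)%N]card_ord max_card.
rewrite /curv !level_zsimplex; [|lia|lia|lia].
have -> : (d - m = k.+2)%N by lia.
have -> : (d - m.+1 = k.+1)%N by lia.
have -> : (d - m.+2 = k)%N by lia.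
set n := #|J| in Jd *; set e := (d - n)%N.
have b2 : 2 * 'C(n, 2)%:R = n%:R * (n%:R - 1) :> R.
  case: n {Jd e} => [|n]; first by rewrite bin0n mulr0 mul0r.
  by have := mul_bin_diag n.+1 1; rewrite bin1 /= => /(congr1 (fun i => i%:R : R));
    rewrite !natrM => <-; rewrite -natr1; ring.
have [me|em] := leqP m e; last by rewrite !(@bin_small e) ?natrM; [ring|lia|lia|lia].
pose E : R := (e - m)%:R.
have nE : n%:R = k%:R + 2 - E.
  have -> : (k%:R + 2 - E) = (k + 2 - (e - m))%:R by rewrite natrB ?natrD //; lia.
  by congr (_%:R); lia.
have h1 : m.+1%:R * 'C(e, m.+1)%:R = E * 'C(e, m)%:R.
  by rewrite -!natrM mul_bin_left.
have h2 : m.+2%:R * 'C(e, m.+2)%:R = (E - 1) * 'C(e, m.+1)%:R.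
  (* If [e = m], truncated subtraction does not give [E - 1], but ['C(e, m.+1)] is 0. *)
  rewrite -natrM mul_bin_left natrM; have [em|me'] := leqP e m.
    by rewrite bin_small //; ring.
  by congr (_ * _); rewrite /E (_ : (e - m = (e - m.+1).+1)%N) -?natr1 ?addrK //; lia.
rewrite !factS !natrM.
transitivity (m`!%:R * k`!%:R * (k.+2%:R * k.+1%:R * 'C(e, m)%:R
   - 2 * k.+1%:R * (m.+1%:R * 'C(e, m.+1)%:R) + m.+1%:R * (m.+2%:R * 'C(e, m.+2)%:R)) : R).
  by ring.
rewrite h2 [m.+1%:R * ((E - 1) * _)]mulrCA h1.
transitivity (m`!%:R * k`!%:R * (2 * 'C(n, 2)%:R) * 'C(e, m)%:R : R); last by ring.
by rewrite b2 nE -!natr1; ring.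
Qed.

End LevelSums.

(** * Invariant Minkowski linear functionals and the cone spanned by the [fk] *)

Section LinearFunctionals.
Set Implicit Arguments.
Unset Strict Implicit.
Unset Printing Implicit Defensive.
Variables (R : realType) (d : nat).
Implicit Types (I J : {set 'I_d}) (s : 'S_d) (z : {set 'I_d} -> R) (phi : functional R d).

Lemma mink_linear_base phi l m z z' : mink_linear phi -> 0 <= l -> 0 <= m ->
  submod z -> submod z' ->
  phi (base (fun I => l * z I + m * z' I)) = l * phi (base z) + m * phi (base z').
Proof.
move=> [_ _ hphi] l0 m0 hz hz'.
rewrite -hphi //; try exact: genperm_of_submod.
by rewrite !base_dilate // base_add //; apply: submodZ.
Qed.

Lemma mink_linear_sum phi (T : Type) (r : seq T) (P : pred T) (c : T -> R)
    (F : T -> {set 'I_d} -> R) : mink_linear phi ->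
  (forall t, P t -> 0 <= c t) -> (forall t, P t -> submod (F t)) ->
  phi (base (fun I => \sum_(t <- r | P t) c t * F t I))
    = \sum_(t <- r | P t) c t * phi (base (F t)).
Proof.
move=> hphi hc hF; elim: r => [|t r IHr].
  (* The empty sum is the zero set function; linearity with both scalars 0 gives the value 0 on its
     base polytope. *)
  rewrite big_nil; have h0 : submod (fun _ : {set 'I_d} => 0 : R).
    by split=> // *; rewrite addr0.
  have := mink_linear_base hphi (lexx 0) (lexx 0) h0 h0; rewrite !mul0r addr0 => e.
  by rewrite -[RHS]e; congr (phi (base _)); apply: funext => I; rewrite big_nil ?mul0r ?addr0.
rewrite big_cons; case: ifPn => Pt; last first.
  by rewrite -IHr; congr (phi (base _)); apply: funext => I; rewrite big_cons (negPf Pt).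
have hs : submod (fun I => \sum_(t <- r | P t) c t * F t I).
  by apply: submod_sum => u Pu; apply: submodZ; [exact: hc | exact: hF].
rewrite -IHr -[X in _ + X]mul1r -mink_linear_base ?hc ?ler01 //; last exact: hF.
by congr (phi (base _)); apply: funext => I; rewrite big_cons Pt mul1r.
Qed.

Definition invariant_functional phi :=
  [/\ mink_linear phi, translation_invariant phi & symmetric_functional phi].

Lemma invariant_decomposition phi z : invariant_functional phi -> submod z ->
  d`!%:R * phi (base z) = \sum_(0 <= j < d.-1) curv j z * phi (base (zhyper R j.+1)).
Proof.
move=> [hl ht hs] hz.
have -> : d`!%:R * phi (base z) =
    phi (base (fun I => \sum_(s : 'S_d) 1 * z [set s i | i in I]%SET)).
  rewrite (mink_linear_sum _ hl) // => [|s _]; last exact: submod_perm.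
  rewrite (eq_bigr (fun=> phi (base z))).
    by rewrite sumr_const mulr_natl; congr (_ *+ _); symmetry; exact: card_Sn.
  by move=> s _; rewrite mul1r -base_permute hs //; exact: genperm_of_submod.
(* Minkowski linearity covers nonnegative coefficients only, which the curvatures are. *)
have cj j : (0 <= j < d.-1)%N -> 0 <= curv j z by move=> jd; apply: curv_ge0 => //; lia.
rewrite [RHS]big_nat -(mink_linear_sum _ hl) // => [|j _]; last exact: submod_zhyper.
set S := (X in _ = phi (base X)); have hS : submod S.
  by apply: submod_sum => j jd; apply: submodZ; [exact: cj | exact: submod_zhyper].
rewrite -(ht _ (const_mx (level d z - level d.-1 z)) (genperm_of_submod hS)).
rewrite base_translate; congr (phi (base _)); apply: funext => I /=.
by under eq_bigr do rewrite mul1r; rewrite symmetrization // addrC /S -big_nat.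
Qed.

(** The constant of [curv_zsimplex] for the splitting [d = (d.-1 - k) + k.-1.+2]; dividing by it
    leaves the values of [f_value] at simplices. *)
Definition norm_const (k : nat) : R := (2 * (d.-1 - k)`! * k.-1`!)%:R.

Definition curv_functional (k : nat) : functional R d := fun P =>
  if `[< genperm P >] then curv (d.-1 - k) (zof P) / norm_const k else 0.

Lemma norm_const_gt0 k : 0 < norm_const k.
Proof. by rewrite ltr0n !muln_gt0 !fact_gt0. Qed.

Lemma curv_functional_base k z : submod z ->
  curv_functional k (base z) = curv (d.-1 - k) z / norm_const k.
Proof.
move=> hz; rewrite /curv_functional asboolT ?zof_base //.
exact: genperm_of_submod.
Qed.

Lemma curv_functional_linear k : mink_linear (curv_functional k).
Proof.
have h0 A : ~ genperm A -> curv_functional k A = 0.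
  by move=> hA; rewrite /curv_functional asboolF.
split=> // [|P Q l m /genperm_zof[hP eP] /genperm_zof[hQ eQ] l0 m0].
  apply: h0 => /genperm_zof[h e].
  by have : base (zof set0) (vtx 1%g (zof set0)) := base_vtx _ h; rewrite -e.
rewrite eP eQ !base_dilate // base_add; try exact: submodZ.
rewrite !curv_functional_base //; last by apply: submodD; apply: submodZ.
by rewrite curv_linear; ring.
Qed.

Lemma curv_functional_translation k : (0 < k < d)%N -> translation_invariant (curv_functional k).
Proof.
move=> kd P t /genperm_zof[hP eP]; rewrite eP base_translate.
rewrite !curv_functional_base //; last exact: submodD (submod_wt t).
have -> : zof P \+ wt t = fun I => 1 * zof P I + 1 * wt t I.
  by apply: funext => I; rewrite !mul1r.
by rewrite curv_linear curv_wt ?mulr0 ?addr0 ?mul1r //; lia.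
Qed.

Lemma curv_functional_symmetric k : symmetric_functional (curv_functional k).
Proof.
move=> P s /genperm_zof[hP eP]; rewrite eP base_permute.
by rewrite !curv_functional_base ?curv_perm //; exact: submod_perm.
Qed.

Lemma curv_functional_positive k : (0 < k < d)%N -> positive (curv_functional k).
Proof.
move=> kd P /genperm_zof[hP eP]; rewrite eP curv_functional_base //.
by rewrite divr_ge0 ?(ltW (norm_const_gt0 k)) // curv_ge0 //; lia.
Qed.

(** Up to positive factors, these functionals are dual to the hypersimplices; linear independence is
    read off from this. *)
Lemma curv_functional_zhyper k j : (0 < k < d)%N -> (0 < j < d)%N ->
  curv_functional k (base (zhyper R (d - j))) = (k == j)%:R * (d`!%:R / norm_const k).
Proof.
move=> kd jd; rewrite curv_functional_base; last exact: submod_zhyper.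
rewrite (_ : (d - j = (d.-1 - j).+1)%N) ?curv_zhyper; [|lia|lia].
rewrite (_ : (_ - k == _)%N = (k == j)) ?mulrA //.
by apply/eqP/eqP; lia.
Qed.

Lemma curv_functional_simplex k i : (0 < k < d)%N -> (0 < i < d)%N ->
  curv_functional k (std_simplex R d i.+1) = (f_value d k i)%:R.
Proof.
move=> kd id; rewrite /std_simplex simplexE curv_functional_base; last exact: submod_zsimplex.
rewrite (@curv_zsimplex _ _ _ k.-1); last lia.
rewrite mulrAC divff ?gt_eqF ?norm_const_gt0 // mul1r.
have -> : #|[set j : 'I_d | (j < i.+1)%N]%SET| = i.+1.
  rewrite -[RHS](@card_initseg d 1%g); last lia.
  by apply: eq_card => j; rewrite !inE perm1.
(* For [i <= k] this is the symmetry of binomials; for [k < i] the lower index [d.-1 - k] exceeds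
   [d - i.+1], in accordance with the guard in [f_value]. *)
rewrite /f_value; congr (_ * _)%:R; case: leqP => ik; last by rewrite bin_small //; lia.
rewrite -bin_sub; last by lia.
by congr 'C(_, _); lia.
Qed.

Definition coef phi k : R := norm_const k / d`!%:R * phi (base (zhyper R (d - k))).

Lemma factR_neq0 : d`!%:R != 0 :> R.
Proof. by rewrite pnatr_eq0 -lt0n fact_gt0. Qed.

Lemma invariant_sum phi : invariant_functional phi ->
  phi = \sum_(1 <= k < d) coef phi k *: curv_functional k.
Proof.
move=> hphi; have [hl ht hs] := hphi; apply: funext => P.
rewrite fct_sumE.
have [gP|gP] := pselect (genperm P); last first.
  rewrite (_ : phi P = 0); last by case: hl => h _ _; exact: h.
  rewrite big1 // => k _.
  by rewrite scalrfctE /curv_functional asboolF // scaler0.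
have [hz eP] := genperm_zof gP; rewrite eP; set z := zof P in hz *.
apply: (mulfI factR_neq0); rewrite (invariant_decomposition hphi hz) mulr_sumr.
have [d0|dp] := posnP d; first by rewrite !big_geq // d0.
(* Reversing the sum matches the curvature index [j] with [k = d.-1 - j]. *)
rewrite -[d in index_iota 1 d](prednK dp) big_add1 /= big_nat_rev [RHS]big_nat [LHS]big_nat /=.
apply: eq_bigr => k kd; rewrite scalrfctE curv_functional_base //.
rewrite add0n /coef.
have -> : (d - k.+1 = (d.-1 - k.+1).+1)%N by lia.
set a := phi _; set b := curv _ _.
have -> : forall u v : R, u *: (v : R^o) = u * v by [].
have : norm_const k.+1 != 0 by rewrite gt_eqF // norm_const_gt0.
move: (norm_const _) factR_neq0 => c f0 c0.
by field; rewrite c0 f0.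
Qed.

(** The matrix is triangular, as [f_value d k i] is 0 for [k < i], with diagonal entries
    ['C(k.+1, 2)]; the unknowns are eliminated from [k = d.-1] downwards. *)
Lemma f_value_triangular (a : nat -> R) :
  (forall i, (0 < i < d)%N -> \sum_(1 <= k < d) a k * (f_value d k i)%:R = 0) ->
  forall k, (0 < k < d)%N -> a k = 0.
Proof.
move=> h k; have [n] := ubnP (d - k); elim: n k => // n IHn k kn kd.
have := h k kd; rewrite (bigD1_seq k) ?mem_index_iota ?iota_uniq //=.
rewrite big_nat_cond big1 ?addr0.
  move/eqP; rewrite mulf_eq0 => /orP[/eqP //|].
  rewrite /f_value leqnn subnn bin0 muln1 pnatr_eq0 -leqn0 leqNgt bin_gt0; lia.
move=> j /andP[jd jk]; have [kj|jk'] := ltnP k j.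
  by rewrite (IHn j) ?mul0r //; lia.
by rewrite /f_value leqNgt (_ : (j < k)%N) /= ?muln0 ?mulr0 //; lia.
Qed.

(** The functional [curv_functional k] has the defining properties of [fk], and the values at the
    standard simplices determine an invariant functional by triangularity. *)
Lemma fkE k : (0 < k < d)%N -> fk R d k = curv_functional k.
Proof.
move=> kd; set S := [set phi : functional R d |
    [/\ mink_linear phi, translation_invariant phi, symmetric_functional phi
      & forall i, (1 <= i <= d.-1)%N ->
          phi (std_simplex R d i.+1) = (f_value d k i)%:R]].
have : S (fk R d k).
  apply: xgetPex; exists (curv_functional k); split.
  - exact: curv_functional_linear.
  - exact: curv_functional_translation.
  - exact: curv_functional_symmetric.
  - by move=> i id; apply: curv_functional_simplex => //; lia.
move: (fk R d k) => phi [hl ht hs hv].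
have hphi : invariant_functional phi by [].
(* Expanding [phi] by [invariant_sum] and evaluating at the simplices puts this difference in the
   kernel of the triangular matrix. *)
have e : forall j, (0 < j < d)%N -> coef phi j - (j == k)%:R = 0.
  apply: f_value_triangular => i id.
  under eq_bigr do rewrite mulrBl.
  rewrite sumrB [X in _ - X](bigD1_seq k) ?mem_index_iota ?iota_uniq //= eqxx mul1r.
  rewrite [X in _ - (_ + X)]big1 ?addr0 => [|j /negPf->]; last by rewrite mul0r.
  rewrite -hv; last by lia.
  rewrite {2}(invariant_sum hphi) fct_sumE; apply/eqP; rewrite subr_eq0; apply/eqP.
  by apply: eq_big_nat => j jd; rewrite scalrfctE curv_functional_simplex.
rewrite (invariant_sum hphi) (bigD1_seq k) ?mem_index_iota ?iota_uniq //=.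
rewrite big_nat_cond big1 ?addr0 => [|j /andP[jd /negPf jk]].
  by have /eqP := e k kd; rewrite eqxx subr_eq0 => /eqP->; rewrite scale1r.
by have /eqP := e j jd; rewrite jk subr0 => /eqP->; rewrite scale0r.
Qed.

Lemma invariant_sum_fk phi : invariant_functional phi ->
  phi = \sum_(1 <= k < d) coef phi k *: fk R d k.
Proof.
move=> hphi; rewrite {1}(invariant_sum hphi).
by apply: eq_big_nat => k kd; rewrite fkE.
Qed.

Lemma coef_ge0 phi k : positive phi -> 0 <= coef phi k.
Proof.
move=> pphi; rewrite mulr_ge0 ?divr_ge0 ?ler0n //.
by apply: pphi; apply: genperm_of_submod; exact: submod_zhyper.
Qed.

Lemma sum_fk_invariant (c : nat -> R) (phi := \sum_(1 <= k < d) c k *: fk R d k) :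
  (forall k, (0 < k < d)%N -> 0 <= c k) ->
  [/\ mink_linear phi, positive phi, translation_invariant phi & symmetric_functional phi].
Proof.
move=> c0.
have E P : phi P = \sum_(1 <= k < d) c k * curv_functional k P.
  rewrite /phi fct_sumE; apply: eq_big_nat => k kd.
  by rewrite fkE.
have L k := curv_functional_linear k.
split.
- split=> [A hA||P Q l m gP gQ l0 m0]; rewrite !E.
  + by rewrite big1 // => k _; have [h _ _] := L k; rewrite (h _ hA) mulr0.
  + by rewrite big1 // => k _; have [_ -> _] := L k; rewrite mulr0.
  + rewrite !mulr_sumr -big_split; apply: eq_bigr => k _ /=.
    by have [_ _ ->] := L k => //; ring.
- move=> P gP; rewrite E big_nat; apply: sumr_ge0 => k kd.
  by rewrite mulr_ge0 ?c0 ?curv_functional_positive.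
- move=> P t gP; rewrite !E; apply: eq_big_nat => k kd.
  by rewrite curv_functional_translation.
- move=> P s gP; rewrite !E; apply: eq_big_nat => k kd.
  by rewrite curv_functional_symmetric.
Qed.

(** Evaluation at the hypersimplex [zhyper R (d - i.+1)] isolates the coefficient of index [i]. *)
Lemma fk_lin_indep : lin_indep (fun i : 'I_d.-1 => fk R d i.+1).
Proof.
move=> a /(congr1 (fun phi : functional R d => phi (base (zhyper R (d - _))))) h i.
have id : (0 < i.+1 < d)%N by have := ltn_ord i; lia.
have := h i.+1; rewrite fct_sumE (bigD1 i) //= big1 => [|j ji].
  rewrite addr0 scalrfctE fkE // curv_functional_zhyper // eqxx mul1r => /eqP.
  rewrite mulf_eq0 => /orP[/eqP //|].
  by rewrite mulf_eq0 invr_eq0 (negPf factR_neq0) gt_eqF // norm_const_gt0.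
have jd : (0 < j.+1 < d)%N by have := ltn_ord j; lia.
rewrite scalrfctE fkE // curv_functional_zhyper // eqSS.
by rewrite (inj_eq val_inj) (negPf ji) mul0r scaler0.
Qed.

End LinearFunctionals.

Theorem theorem3p3 (R : realType) (d : nat) (hd : (2 <= d)%N) :
  (forall phi : functional R d, mink_linear phi ->
     ([/\ positive phi, translation_invariant phi & symmetric_functional phi]
      <->
      exists2 c : nat -> R,
        (forall k, (1 <= k <= d.-1)%N -> 0 <= c k)
        & phi = \sum_(1 <= k < d) c k *: fk R d k)) /\
  simplicial_cone d.-1
    [set phi : functional R d |
      [/\ mink_linear phi, positive phi, translation_invariant phi
        & symmetric_functional phi]].
Proof.
have bnd k : (0 < k < d)%N -> (1 <= k <= d.-1)%N by lia.
split=> [phi hl|]; first split=> [[hp ht hs]|[c c0 ->]].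
- exists (coef phi) => [k _|]; first exact: coef_ge0.
  exact: invariant_sum_fk.
- by have [] := @sum_fk_invariant R d c (fun k kd => c0 k (bnd k kd)).
exists (fun i : 'I_d.-1 => fk R d i.+1); first exact: fk_lin_indep.
have sumE (c : nat -> R) :
    \sum_(1 <= k < d) c k *: fk R d k = \sum_(i < d.-1) c i.+1 *: fk R d i.+1.
  by rewrite -[d in index_iota _ d]prednK 1?ltnW // big_add1 /= big_mkord.
apply/seteqP; split=> [phi [hl hp ht hs]|phi [c c0 ->]].
  exists (fun i : 'I_d.-1 => coef phi i.+1) => [i|]; first exact: coef_ge0.
  by rewrite -sumE; exact: invariant_sum_fk.
(* The family on ['I_d.-1] is shifted by one and extended by 0 to all naturals, which preserves
   nonnegativity. *)
pose c' k := if insub k.-1 is Some i then c i else 0.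
have -> : \sum_(i < d.-1) c i *: fk R d i.+1 = \sum_(1 <= k < d) c' k *: fk R d k.
  by rewrite sumE; apply: eq_bigr => i _; rewrite /c' /= valK.
by apply: sum_fk_invariant => k _; rewrite /c'; case: insubP.
Qed.
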